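(* Let $(P,\preceq,\vee)$ be a locally finite join semilattice, $S=\{x_1,x_2,\ldots,x_n\}$ a finite subset of $P$ (with $n\ge 1$) such that $x_i\preceq x_j$ only if $i\leq j$, $f:P\to\mathbb{C}$ a function on $P$, and $d\ge 2$ an integer. Let $S^{\vee d}=\{y_1,y_2,\ldots,y_r\}$, $r=\#S^{\vee d}$, be ordered such that $y_i\preceq y_j$ only if $i\leq j$, and assume that $f$ satisfies \[ c_k=\sum_{s:\,y_k\preceq y_s}f(y_s)\,\mu_{S^{\vee d}}(y_k,y_s)\neq 0\quad\text{for all }k\in\{1,2,\ldots,r\}. \] If in addition $n\leq\lfloor d/2\rfloor$, then \[ \mathrm{rank}_{\mathrm{TT}}[S_d]_f=\# S^{\vee\lfloor d/2\rfloor}. \]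
   Context: A poset $(P,\preceq)$ is locally finite if $\{z\in P\mid x\preceq z\preceq y\}$ is finite for all $x,y\in P$. A join semilattice is a nonempty poset in which any two elements $x,y$ have a least upper bound $x\vee y$. For $S=\{x_1,\ldots,x_n\}\subset P$ and an integer $k\ge 1$, $S^{\vee k}=\{x_{i_1}\vee\cdots\vee x_{i_k}\mid 1\leq i_1\leq\cdots\leq i_k\leq n\}$, and $\#$ denotes cardinality. The order $d$ join tensor on $S$ with respect to $f$ is the $n$-dimensional order $d$ tensor with $([S_d]_f)_{i_1,\ldots,i_d}=f(x_{i_1}\vee\cdots\vee x_{i_d})$, $i_1,\ldots,i_d\in\{1,\ldots,n\}$. $\mu_{S^{\vee d}}$ denotes the Möbius function of the finite poset $(S^{\vee d},\preceq)$: $\mu(x,x)=1$, $\mu(x,y)=-\sum_{x\preceq z\prec y}\mu(x,z)$ if $x\prec y$ (sum over $z\in S^{\vee d}$), and $\mu(x,y)=0$ otherwise. For an $n$-dimensional order $d$ complex tensor $A$ and $1\le k\le d-1$, the $k$-th unfolding matrix $A_k$ is the $n^k\times n^{d-k}$ matrix with rows enumerated by $(i_1,\ldots,i_k)$, columns by $(i_{k+1},\ldots,i_d)$, and entries $(A_k)_{(i_1,\ldots,i_k),(i_{k+1},\ldots,i_d)}=A_{i_1,\ldots,i_d}$. The TT-rank of $A$ is $\mathrm{rank}_{\mathrm{TT}}A=\max_{1\leq k\leq d-1}\mathrm{rank}\,A_k$. *)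

(* Defs.v *)
From HB Require Import structures.
From mathcomp Require Import all_boot all_order all_algebra finmap.
From mathcomp Require Import complex.
From mathcomp Require Import classical_sets cardinality reals.

Set Implicit Arguments.
Unset Strict Implicit.
Unset Printing Implicit Defensive.

Import Order.TTheory GRing.Theory Num.Theory.
Local Open Scope ring_scope.

(* The complex numbers are R[i], for R an arbitrary model of the reals. *)

Definition locally_finite (disp : Order.disp_t) (P : porderType disp) : Prop :=
  forall a b : P, finite_set [set z : P | (a <= z <= b)%O]%classic.

(* A join semilattice need not have a bottom, so only the empty sequence has   *)
(* no join.                                                                    *)
Definition seq_join (disp : Order.disp_t) (P : joinSemilatticeType disp)
    (s : seq P) : option P :=
  if s is a :: s' then Some (foldl Order.join a s') else None.

(* S^{\/ k} for S = {x_0, ..., x_(n-1)}; it is only meaningful for k >= 1, and *)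
(* k = 0 yields the empty set.                                                 *)
Definition join_power (disp : Order.disp_t) (P : joinSemilatticeType disp)
    (n : nat) (x : 'I_n -> P) (k : nat) : {fset P} :=
  [fset y in pmap (fun t : k.-tuple 'I_n => seq_join (map x t))
                  [seq t : k.-tuple 'I_n <- enum {: k.-tuple 'I_n}
                     | sorted leq (map val t)]]%fset.

Section Mobius.
Variables (disp : Order.disp_t) (P : porderType disp) (T : {fset P}).

(* The recursion defining the Moebius function is on strictly decreasing       *)
(* second arguments in T; the first argument bounds its depth.                 *)
Fixpoint mobius_fuel (m : nat) (a b : P) : int :=
  if m is m'.+1 then
    if a == b then 1
    else if (a < b)%O then
      - \sum_(z <- T | (a <= z)%O && (z < b)%O) mobius_fuel m' a z
    else 0
  else 0.

Definition mobius (a b : P) : int := mobius_fuel #|` T|.+1 a b.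

Let depth (a b : P) := count (fun z => (a <= z)%O && (z < b)%O) T.

Let depth_lt (a b z : P) :
  z \in T -> (a <= z)%O -> (z < b)%O -> (depth a z < depth a b)%N.
Proof.
move=> zT az zb; rewrite /depth.
have -> : count (fun w => (a <= w)%O && (w < b)%O) T =
  (count (fun w => (a <= w)%O && (w < z)%O) T +
   count (fun w => [&& (a <= w)%O, (w < b)%O & ~~ (w < z)%O]) T)%N.
  rewrite -count_predUI [X in (_ + X)%N](_ : _ = 0%N) ?addn0; last first.
    rewrite -(count_pred0 T); apply: eq_count => w /=.
    by case: (w < z)%O; rewrite !(andbT, andbF).
  apply: eq_count => w /=; case wz: (w < z)%O; rewrite ?andbT ?andbF ?orbF //=.
  by rewrite (lt_trans wz zb) andbT.
rewrite -[X in (X < _)%N]addn0 ltn_add2l -has_count.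
by apply/hasP; exists z => //=; rewrite az zb ltxx.
Qed.

Let fuel_irr (m m' : nat) (a b : P) :
  (depth a b < m)%N -> (depth a b < m')%N ->
  mobius_fuel m a b = mobius_fuel m' a b.
Proof.
elim: m m' b => [|m IH] [|m'] b //= hm hm'.
case: eqP => // _; case: ifP => // _; congr (- _).
rewrite big_seq_cond [RHS]big_seq_cond; apply: eq_bigr => z /and3P[zT az zb].
by have h := depth_lt zT az zb; apply: IH; apply: leq_trans h _.
Qed.

Lemma mobiusE (a b : P) :
  mobius a b =
    if a == b then 1
    else if (a < b)%O then
      - \sum_(z <- T | (a <= z)%O && (z < b)%O) mobius a z
    else 0.
Proof.
rewrite {1}/mobius /=; case: eqP => // _; case: ifP => // ab; congr (- _).
rewrite big_seq_cond [RHS]big_seq_cond; apply: eq_bigr => z /and3P[zT az zb].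
apply: fuel_irr; last by rewrite ltnS count_size.
by apply: leq_trans (depth_lt zT az zb) _; rewrite count_size.
Qed.

End Mobius.

Section Tensor.
Variables (F : fieldType) (n d : nat).

Definition tensor := d.-tuple 'I_n -> F.

(* The rows and columns are indexed by the n ^ k, resp. n ^ (d - k), tuples,   *)
(* through enum_val; see card_tuple.                                           *)
Definition unfolding (A : tensor) (k : 'I_d) :
    'M[F]_(#|{: k.-tuple 'I_n}|, #|{: (d - k).-tuple 'I_n}|) :=
  \matrix_(p, q) A (tcast (subnKC (ltnW (ltn_ord k)))
                          (cat_tuple (enum_val p) (enum_val q))).

Definition tt_rank (A : tensor) : nat :=
  \max_(k < d | (0 < k)%N) \rank (unfolding A k).

End Tensor.

(* The value 0 is only reached for d = 0, where the join is undefined.         *)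
Definition join_tensor (F : fieldType) (disp : Order.disp_t)
    (P : joinSemilatticeType disp) (n : nat) (x : 'I_n -> P) (f : P -> F)
    (d : nat) : tensor F n d :=
  fun t => oapp f 0 (seq_join (map x t)).
Arguments join_tensor {F disp P n} x f d.

(* Main.v *)
Require Import Defs.
From HB Require Import structures.
From mathcomp Require Import all_boot all_order all_algebra finmap.
From mathcomp Require Import complex.
From mathcomp Require Import classical_sets cardinality reals.

Import Order.TTheory GRing.Theory Num.Theory.
Local Open Scope ring_scope.

(* By Moebius inversion, f(u \/ v) is the sum of the c_k over the y_k above both
   u and v, so every unfolding factors as E diag(c) G with inner dimension r, and
   its rank is at most r. Since n <= d/2, any element of S^{\/ d} is already a join
   of d/2 elements of S (drop repetitions, then pad), so S^{\/ d/2} = S^{\/ d}. In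
   the middle unfolding E and G thus contain the rows and columns of the invertible
   zeta matrix of S^{\/ d}, and have full rank r. *)

Lemma seq_join_le {disp : Order.disp_t} {P : joinSemilatticeType disp}
  {s : seq P} {a : P} (z : P) :
  seq_join s = Some a -> (a <= z)%O = all (fun b => b <= z)%O s.
Proof.
case: s => //= b s [<-]; elim: s b => [|c s IHs] b /=; first by rewrite andbT.
by rewrite IHs leUx andbA.
Qed.

(** Both joins have the same upper bounds, so antisymmetry identifies them. Hence sorting, removing
    repetitions and padding all preserve a join. *)
Lemma seq_join_eq_mem {disp : Order.disp_t} {P : joinSemilatticeType disp}
  {s t : seq P} : s =i t -> seq_join s = seq_join t.
Proof.
move=> st.
have [s0 t0] : (seq_join s = None -> t = [::]) /\ (seq_join t = None -> s = [::]).
  split; [case: s st | case: t st] => // st _; apply/eqP; rewrite -size_eq0.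
    by case: t st => // b t /(_ b); rewrite mem_head.
  by case: s st => // b s /(_ b); rewrite mem_head.
case Es: (seq_join s) => [a|]; last by rewrite s0.
case Et: (seq_join t) => [b|]; last by move: Es; rewrite t0.
congr Some; apply/le_anti.
rewrite (seq_join_le _ Es) (eq_all_r st) -(seq_join_le _ Et) lexx.
by rewrite (seq_join_le _ Et) -(eq_all_r st) -(seq_join_le _ Es) lexx.
Qed.

Lemma seq_join_exists {disp : Order.disp_t} {P : joinSemilatticeType disp}
  (s : seq P) : (0 < size s)%N -> exists a, seq_join s = Some a.
Proof. by case: s => // a s _; exists (foldl Order.join a s). Qed.

(** Sorting a tuple does not change its join, so the restriction to sorted index tuples can be
    forgotten. *)
Lemma join_powerP {disp : Order.disp_t} {P : joinSemilatticeType disp} {n : nat}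
  (x : 'I_n -> P) (k : nat) (a : P) :
  a \in join_power x k <-> exists t : k.-tuple 'I_n, seq_join (map x t) = Some a.
Proof.
rewrite in_fset mem_pmap; split=> [/mapP[t _ ->]|[t ta]]; first by exists t.
apply/mapP; exists (sort_tuple (fun i j : 'I_n => i <= j)%N t).
  rewrite mem_filter mem_enum andbT sorted_map.
  by apply: sort_sorted => i j; apply: leq_total.
by rewrite -ta; apply/seq_join_eq_mem/eq_mem_map => i; rewrite mem_sort.
Qed.

(** Without repetitions [i :: s] has at most [n] entries; copies of [i] then fill it up to length
    [m]. *)
Lemma tuple_eq_mem {n m : nat} (s : seq 'I_n) :
  (0 < size s)%N -> (n <= m)%N -> exists t : m.-tuple 'I_n, t =i s.
Proof.
case: s => // i s _ nm; set u := undup (i :: s).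
have um : (size u <= m)%N.
  rewrite (leq_trans _ nm) // -[n in leqRHS]card_ord.
  by rewrite -(card_uniqP (undup_uniq (i :: s))) max_card.
have szt : size (u ++ nseq (m - size u) i) == m.
  by rewrite size_cat size_nseq subnKC.
exists (Tuple szt) => j; rewrite mem_cat mem_undup mem_nseq.
by case: (j \in i :: s) / boolP => //=; rewrite in_cons negb_or => /andP[/negPf-> _];
  rewrite andbF.
Qed.

Lemma join_power_tuple {disp : Order.disp_t} {P : joinSemilatticeType disp}
  {n : nat} {x : 'I_n -> P} {k m : nat} {a : P} :
  (0 < k)%N -> (n <= m)%N -> a \in join_power x k ->
  exists t : m.-tuple 'I_n, seq_join (map x t) = Some a.
Proof.
move=> k_gt0 nm /join_powerP[t ta].
have [|u ut] := @tuple_eq_mem n m t _ nm; first by rewrite size_tuple.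
by exists u; rewrite -ta; apply/seq_join_eq_mem/eq_mem_map.
Qed.

Lemma join_power_stable {disp : Order.disp_t} {P : joinSemilatticeType disp}
  {n : nat} (x : 'I_n -> P) {k m : nat} :
  (0 < n)%N -> (n <= k)%N -> (n <= m)%N -> join_power x k = join_power x m.
Proof.
move=> n_gt0 nk nm; apply/fsetP => a; apply/idP/idP => ax; apply/join_powerP.
  exact: join_power_tuple (leq_trans n_gt0 nk) nm ax.
exact: join_power_tuple (leq_trans n_gt0 nm) nk ax.
Qed.

Section MobiusInversion.
Context {F : fieldType} {disp : Order.disp_t} {P : porderType disp}.
Context {T : {fset P}} {r : nat} {y : 'I_r -> P}.
Hypotheses (y_inj : injective y) (y_enum : [fset y k | k in 'I_r]%fset = T).

Definition zeta_mx : 'M[F]_r := \matrix_(i, j) (y i <= y j)%O%:R.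

Definition mobius_mx : 'M[F]_r := \matrix_(i, j) (mobius T (y i) (y j))%:~R.

Lemma sum_fset_enum (Q : pred P) (G : P -> int) :
  \sum_(z <- T | Q z) G z = \sum_(k | Q (y k)) G (y k).
Proof.
have Ty : perm_eq T [seq y k | k <- enum 'I_r].
  apply: uniq_perm; rewrite ?fset_uniq ?(map_inj_uniq y_inj) -?enumT ?enum_uniq // => z.
  rewrite -[LHS]/(z \in T) -y_enum.
  by apply/imfsetP/mapP => -[k _ ->]; exists k => //; rewrite mem_enum.
by rewrite (perm_big _ Ty) big_map big_enum_cond.
Qed.

Lemma mobius_eq0 (a b : P) : ~~ (a <= b)%O -> mobius T a b = 0.
Proof.
move=> ab; rewrite mobiusE; case: eqP ab => [->|_ ab]; first by rewrite lexx.
by case: ifP => // /ltW; rewrite (negPf ab).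
Qed.

(** The term [k = j], expanded by the Moebius recursion, cancels the rest of the sum unless
    [i = j]. *)
Lemma sum_mobius (i j : 'I_r) :
  \sum_(k | (y k <= y j)%O) mobius T (y i) (y k) = (i == j)%:R.
Proof.
rewrite (bigD1 j) //= mobiusE (inj_eq y_inj) sum_fset_enum.
(* Terms with [y k] not above [y i] vanish, which leaves exactly the range of the recursion. *)
have -> : \sum_(k | (y k <= y j)%O && (k != j)) mobius T (y i) (y k) =
    \sum_(k | (y i <= y k)%O && (y k < y j)%O) mobius T (y i) (y k).
  rewrite [LHS](bigID (fun k => y i <= y k)%O) /= [X in _ + X]big1 ?addr0.
    by apply: eq_bigl => k; rewrite andbC lt_neqAle (inj_eq y_inj) [_ && (k != j)]andbC.
  by move=> k /andP[_ /mobius_eq0].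
case: eqVneq => [->|ij].
  by rewrite big1 ?addr0 // => k /andP[jk /(le_lt_trans jk)]; rewrite ltxx.
case: ifP => [_|ijF]; first by rewrite addNr.
by rewrite add0r big1 // => k /andP[ik /(le_lt_trans ik)]; rewrite ijF.
Qed.

Lemma mul_mobius_zeta : mobius_mx *m zeta_mx = 1%:M.
Proof.
apply/matrixP => i j; rewrite !mxE.
transitivity ((\sum_(k | (y k <= y j)%O) mobius T (y i) (y k))%:~R : F).
  rewrite rmorph_sum [RHS]big_mkcond; apply: eq_bigr => k _ /=; rewrite !mxE.
  by case: ifP => _; rewrite ?mulr1 ?mulr0.
by rewrite sum_mobius; case: (i == j).
Qed.

Lemma zeta_mx_unit : zeta_mx \in unitmx.
Proof. by case: (mulmx1_unit mul_mobius_zeta). Qed.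

Lemma mobius_inversion (f : P -> F) (s : 'I_r) :
  \sum_(k | (y s <= y k)%O)
    \sum_(t | (y k <= y t)%O) f (y t) * (mobius T (y k) (y t))%:~R = f (y s).
Proof.
pose v : 'cV[F]_r := \col_t f (y t).
(* The entries of [mobius_mx *m v] are the inner sums. A left inverse of a square matrix is also a
   right inverse, so the product may be swapped. *)
have /matrixP/(_ s 0) : zeta_mx *m (mobius_mx *m v) = v.
  by rewrite mulmxA (mulmx1C mul_mobius_zeta) mul1mx.
rewrite !mxE => <-; rewrite [LHS]big_mkcond; apply: eq_bigr => k _; rewrite !mxE.
case: ifP => _; rewrite ?mul0r // mul1r [LHS]big_mkcond.
apply: eq_bigr => t _; rewrite !mxE mulrC.
by case: ifP => // /negbT/mobius_eq0->; rewrite mul0r.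
Qed.

End MobiusInversion.

Section Unfolding.
Context {F : fieldType} {disp : Order.disp_t} {P : joinSemilatticeType disp}.
Context {n d : nat} {x : 'I_n -> P} {f : P -> F} {r : nat} {y : 'I_r -> P}.
Hypotheses (y_inj : injective y).
Hypotheses (y_enum : [fset y k | k in 'I_r]%fset = join_power x d).

Definition mobius_coef (k : 'I_r) : F :=
  \sum_(t | (y k <= y t)%O) f (y t) * (mobius (join_power x d) (y k) (y t))%:~R.

(** For [m > 0], row [p] is the zeta row of the join of the tuple [p]. Testing entries one by one
    makes it split along concatenation. *)
Definition tuple_zeta_mx (m : nat) : 'M[F]_(#|{: m.-tuple 'I_n}|, r) :=
  \matrix_(p, k) (all (fun b => b <= y k)%O (map x (enum_val p : m.-tuple 'I_n)))%:R.

(** An element lies above the join of a concatenation iff it lies above all entries of both pieces,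
    so the indicator in the inversion formula is a product. *)
Lemma unfolding_factor (k : 'I_d) :
  unfolding (join_tensor x f d) k =
  tuple_zeta_mx k *m diag_mx (\row_l mobius_coef l) *m (tuple_zeta_mx (d - k))^T.
Proof.
apply/matrixP => p q; rewrite !mxE /join_tensor.
set t := tcast _ _.
have [|a ta] := seq_join_exists (map x t).
  by rewrite size_map size_tuple (leq_trans _ (ltn_ord k)).
have : a \in join_power x d by apply/join_powerP; exists t.
rewrite ta -y_enum => /imfsetP[/= s _ as_].
rewrite as_ -(mobius_inversion y_inj y_enum) big_mkcond; apply: eq_bigr => l _.
rewrite mul_mx_diag !mxE -as_ (seq_join_le _ ta) val_tcast /= map_cat all_cat.
rewrite -/(mobius_coef l).
by case: all; case: all; rewrite /= ?mul1r ?mul0r ?mulr1 ?mulr0.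
Qed.

Lemma unfolding_rank_le (k : 'I_d) :
  (\rank (unfolding (join_tensor x f d) k) <= r)%N.
Proof.
by rewrite unfolding_factor -mulmxA (leq_trans (mxrankM_maxl _ _)) // rank_leq_col.
Qed.

Lemma tuple_zeta_rank (m : nat) :
  (0 < d)%N -> (n <= m)%N -> \rank (tuple_zeta_mx m) = r.
Proof.
move=> d_gt0 nm; apply/eqP; rewrite eqn_leq rank_leq_col /=.
have ty i : exists t : m.-tuple 'I_n, seq_join (map x t) == Some (y i).
  have [|t /eqP] := @join_power_tuple _ _ n x d m (y i) d_gt0 nm; last by exists t.
  by rewrite -y_enum; apply/imfsetP; exists i.
(* [g] picks for each [y i] the row of an [m]-tuple with join [y i]; these rows form [zeta_mx],
   which is invertible. *)
pose g i := enum_rank (xchoose (ty i)).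
have gr : \rank (rowsub g (tuple_zeta_mx m)) = r.
  rewrite -[RHS](mxrank_unit (@zeta_mx_unit F _ _ _ _ _ y_inj y_enum)).
  congr mxrank; apply/matrixP => i j.
  by rewrite !mxE enum_rankK -(seq_join_le _ (eqP (xchooseP (ty i)))).
by rewrite -[leqLHS]gr; apply/mxrankS/rowsub_sub.
Qed.

Lemma unfolding_rank_eq (k : 'I_d) : (n <= k)%N -> (n <= d - k)%N ->
  (forall l, mobius_coef l != 0) ->
  \rank (unfolding (join_tensor x f d) k) = r.
Proof.
move=> nk ndk c_neq0.
have d_gt0 : (0 < d)%N by apply: leq_ltn_trans (ltn_ord k).
(* The diagonal factor is invertible and the last factor has full row rank, so both can be cancelled
   without changing the rank. *)
rewrite unfolding_factor !mxrankMfree ?tuple_zeta_rank //.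
  rewrite row_free_unit unitmxE det_diag unitfE.
  by apply/prodf_neq0 => l _; rewrite mxE.
by rewrite /row_free mxrank_tr tuple_zeta_rank.
Qed.

End Unfolding.

Theorem corollary4p2 (R : realType) (disp : Order.disp_t)
  (P : joinSemilatticeType disp) (P_lf : locally_finite P)
  (n : nat) (n_gt0 : (0 < n)%N) (x : 'I_n -> P)
  (x_ord : forall i j : 'I_n, (x i <= x j)%O -> (i <= j)%N)
  (f : P -> R[i]) (d : nat) (d_ge2 : (2 <= d)%N)
  (r : nat) (r_card : r = #|` join_power x d|) (y : 'I_r -> P)
  (y_enum : [fset y k | k in 'I_r]%fset = join_power x d)
  (y_ord : forall i j : 'I_r, (y i <= y j)%O -> (i <= j)%N)
  (c_neq0 : forall k : 'I_r,
     \sum_(s < r | (y k <= y s)%O)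
        f (y s) * (mobius (join_power x d) (y k) (y s))%:~R != 0)
  (n_le : (n <= d./2)%N) :
  tt_rank (join_tensor x f d) = #|` join_power x d./2|.
Proof.
have y_inj : injective y.
  by move=> i j yij; apply/val_inj/eqP; rewrite eqn_leq !y_ord // yij.
have half_lt : (d./2 < d)%N.
  by rewrite -divn2 ltn_Pdiv // (leq_trans _ d_ge2).
have n_le_d : (n <= d)%N by apply: leq_trans n_le (ltnW half_lt).
have n_le_codim : (n <= d - d./2)%N.
  apply: leq_trans n_le _; rewrite leq_subRL ?(ltnW half_lt) // addnn.
  by rewrite -[leqRHS]odd_double_half leq_addl.
rewrite (join_power_stable x n_gt0 n_le n_le_d) -r_card.
apply/eqP; rewrite eqn_leq; apply/andP; split.
  by apply/bigmax_leqP => k _; apply: unfolding_rank_le y_enum k.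
(* The cut at [d./2] attains the bound [r]: both sides have length at least [n], and the cut is
   positive because [n] is. *)
have <- := unfolding_rank_eq y_inj y_enum (Ordinal half_lt) n_le n_le_codim c_neq0.
by apply: (leq_bigmax_cond (Ordinal half_lt)); apply: leq_trans n_le.
Qed.
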